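(* Let $n\geq 1$ and consider any coloring of the edges of the complete graph $K_n$ with $3$ colors such that no triangle has its three edges colored with three distinct colors. Then there is a set $S$ of at most two colors such that the graph $G_S$ on the vertex set of $K_n$, consisting of exactly the edges whose color lies in $S$, has chromatic number at least $n^{2/3}$.
   Context: A triangle whose three edges have three distinct colors is called a rainbow triangle; an edge-coloring of a complete graph with no rainbow triangle is called a Gallai coloring. *)

(* Defs.v *)
From mathcomp Require Import all_boot all_order all_algebra.
From mathcomp Require Import reals exp.

Set Implicit Arguments.
Unset Strict Implicit.
Unset Printing Implicit Defensive.

Record sgraph (T : finType) := SGraph {
  adj :> rel T;
  adj_sym : symmetric adj;
  adj_irr : irreflexive adj
}.

Definition colorable (T : finType) (G : sgraph T) (k : nat) : bool :=
  [exists f : {ffun T -> 'I_k}, forall x, forall y, G x y ==> (f x != f y)].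

Lemma colorable_ex (T : finType) (G : sgraph T) : exists k, colorable G k.
Proof.
exists #|T|; apply/existsP; exists [ffun x => enum_rank x].
apply/forallP => x; apply/forallP => y; apply/implyP => Gxy.
rewrite !ffunE (inj_eq enum_rank_inj).
by apply: contraTneq Gxy => ->; rewrite adj_irr.
Qed.

Definition chromatic_number (T : finType) (G : sgraph T) : nat :=
  ex_minn (colorable_ex G).

(* An edge-coloring of the complete graph on T is represented by a function on
   all subsets of T; only its values on the edges [set x; y], x != y, matter. *)
Definition gallai_coloring (T C : finType) (c : {set T} -> C) : Prop :=
  forall x y z : T, uniq [:: x; y; z] ->
    ~~ uniq [:: c [set x; y]; c [set y; z]; c [set x; z]].

Definition color_adj (T C : finType) (c : {set T} -> C) (S : {set C}) : rel T :=
  fun x y => (x != y) && (c [set x; y] \in S).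

Lemma color_adj_sym (T C : finType) (c : {set T} -> C) (S : {set C}) :
  symmetric (color_adj c S).
Proof. by move=> x y; rewrite /color_adj eq_sym setUC. Qed.

Lemma color_adj_irr (T C : finType) (c : {set T} -> C) (S : {set C}) :
  irreflexive (color_adj c S).
Proof. by move=> x; rewrite /color_adj eqxx. Qed.

Definition color_graph (T C : finType) (c : {set T} -> C) (S : {set C}) :
  sgraph T := SGraph (color_adj_sym c S) (color_adj_irr c S).

(* Main.v *)
Require Import Defs.
From mathcomp Require Import all_boot all_order all_algebra.
From mathcomp Require Import reals exp.

(** Write [chi_k] for the chromatic number of the graph of all edges whose color
is not [k].  We show [n ^ 2 <= chi_0 * chi_1 * chi_2] by induction on vertex
sets.  By Gallai's theorem some color class [k] is disconnected, and two
components of color [k] are joined by edges of a single color.  Let [f_l] be a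
proper coloring of the graph avoiding color [l], and let [i], [j] be the other
two colors.  The palettes [f_k(V)] of distinct components [V] are disjoint, and
so are the products [f_i(V) x f_j(V)], so the induction hypothesis and
Cauchy-Schwarz give the bound. *)

Set Implicit Arguments.
Unset Strict Implicit.
Unset Printing Implicit Defensive.

(** * Counting inequalities over finite families *)

(** Square roots are avoided: after doubling, both sides are double sums, and the terms satisfy
    [2 * n i * n j <= p i * q j + q i * p j] by AM-GM. *)
Lemma sum_cauchy_schwarz (I : finType) (P : pred I) (n p q : I -> nat) :
  (forall i, P i -> n i ^ 2 <= p i * q i) ->
  (\sum_(i | P i) n i) ^ 2 <= (\sum_(i | P i) p i) * (\sum_(i | P i) q i).
Proof.
move=> npq.
have sumM (a b : I -> nat) : (\sum_(i | P i) a i) * (\sum_(j | P j) b j)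
    = \sum_(i | P i) \sum_(j | P j) a i * b j.
  by rewrite big_distrl; apply: eq_bigr => i _; rewrite big_distrr.
rewrite -(leq_pmul2l (isT : 0 < 2)) !mul2n -!addnn -mulnn.
rewrite [X in _ <= _ + X]mulnC !sumM -!big_split /=.
apply: leq_sum => i Pi; rewrite -!big_split /=; apply: leq_sum => j Pj.
have := leq_mul (npq i Pi) (npq j Pj); rewrite addnn -mul2n.
move: (n i) (n j) (p i) (p j) (q i) (q j) => a b r s t u ab.
rewrite -(@leq_exp2r _ _ 2) // !expnMn.
apply: leq_trans (nat_AGM2 _ _).1.
by rewrite leq_pmul2l // (leq_trans ab) // [s * u]mulnC mulnACA.
Qed.

Lemma sum_card_disjoint (I D : finType) (P : {set I}) (F : I -> {set D})
    (A : {set D}) :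
  (forall i, i \in P -> F i \subset A) ->
  (forall i j d, i \in P -> j \in P -> d \in F i -> d \in F j -> i = j) ->
  \sum_(i in P) #|F i| <= #|A|.
Proof.
move=> FA Finj.
have -> : \sum_(i in P) #|F i| = \sum_(d in A) \sum_(i in P) (d \in F i).
  rewrite exchange_big; apply: eq_bigr => i Pi /=.
  rewrite -big_mkcondr -sum1_card; apply: eq_bigl => d /=.
  by apply/idP/andP => [dF|[]//]; split=> //; apply: (subsetP (FA i Pi)).
rewrite -sum1_card; apply: leq_sum => d _.
rewrite -big_mkcondr sum1_card; apply/card_le1_eqP => i j.
by case/andP=> Pi di /andP[Pj dj]; exact: Finj dj di.
Qed.

Lemma third_color (k l : 'I_3) : exists m : 'I_3, (m != k) && (m != l).
Proof.
have /card_gt0P[m] : 0 < #|~: [set k; l]|.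
  by rewrite cardsCs setCK card_ord cards2; case: (k != l).
by rewrite !inE negb_or; exists m.
Qed.

Lemma color_cases (k l m a : 'I_3) :
  k != l -> m != k -> m != l -> [|| a == k, a == l | a == m].
Proof.
by case: k l m a => [[|[|[|//]]] ?] [[|[|[|//]]] ?] [[|[|[|//]]] ?]
  [[|[|[|//]]] ?].
Qed.

Lemma prod_ord3 (F : 'I_3 -> nat) (k l m : 'I_3) :
  k != l -> m != k -> m != l -> \prod_i F i = F k * (F l * F m).
Proof.
move=> kl mk ml; rewrite (bigD1 k) //= (bigD1 l) 1?eq_sym //= (bigD1 m) ?mk //=.
rewrite big1 ?muln1 // => i /andP[/andP[ik il] im].
by have := color_cases i kl mk ml; rewrite (negPf ik) (negPf il) (negPf im).
Qed.

(** * Components of a color class and Gallai's theorem *)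

Section Gallai.
Variables (T : finType) (c : {set T} -> 'I_3).
Hypothesis hc : gallai_coloring c.

Let w x y := c [set x; y].

Let wC x y : w x y = w y x. Proof. by rewrite /w setUC. Qed.

Lemma gallai_triangle x y z : x != y -> y != z -> x != z ->
  [|| w x y == w y z, w x y == w x z | w y z == w x z].
Proof.
move=> xy yz xz; have := hc (x := x) (y := y) (z := z).
rewrite /= !inE !negb_or xy yz xz => /(_ isT).
by rewrite !negb_and !negbK /= orbF -orbA.
Qed.

(** Kept on all of [T], with vertices outside [A] isolated, so that inductions can shrink [A]
    without changing the type. *)
Definition color_rel (A : {set T}) (k : 'I_3) : rel T :=
  [rel x y | [&& x \in A, y \in A, x != y & w x y == k]].

Local Notation conn A k := (connect (color_rel A k)).

Lemma conn_sym (A : {set T}) k : connect_sym (color_rel A k).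
Proof.
apply: sym_connect_sym => x y; rewrite /color_rel /= eq_sym wC.
by rewrite andbCA.
Qed.

Lemma conn_in (A : {set T}) k x y : x \in A -> conn A k x y -> y \in A.
Proof.
move=> xA; apply: contraTT => yA; apply/negP => /connectP[p].
elim: p x xA => [|u p IH] x xA /=; first by move=> _ yx; rewrite yx xA in yA.
by case/andP=> /and4P[_ uA _ _] /IH; apply.
Qed.

Lemma nconn_neq (A : {set T}) k x y : ~~ conn A k x y -> x != y.
Proof. by apply: contraNneq => ->; rewrite connect0. Qed.

Lemma nconn_color (A : {set T}) k x y :
  x \in A -> y \in A -> ~~ conn A k x y -> w x y != k.
Proof.
move=> xA yA nxy; apply: contra (nxy) => wxy; apply: connect1.
by rewrite /color_rel /= xA yA wxy andbT (nconn_neq nxy).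
Qed.

(** Along a [k]-edge from [x] to [u], neither edge to [z] has color [k], so the triangle forces them
    to agree; iterate along the path. *)
Lemma conn_mono (A : {set T}) k x y z : x \in A -> z \in A ->
  conn A k x y -> ~~ conn A k x z -> w y z = w x z.
Proof.
move=> + zA /connectP[p]; elim: p x => [|u p IH] x xA /=; first by move=> _ ->.
case/andP=> /[dup] xu /and4P[_ uA neq_xu /eqP wxu] pth ey nxz.
have nuz : ~~ conn A k u z.
  by apply: contra nxz; apply: connect_trans; apply: connect1.
rewrite (IH u) //; have := gallai_triangle neq_xu (nconn_neq nuz) (nconn_neq nxz).
rewrite wxu ![k == _]eq_sym (negPf (nconn_color _ _ nuz)) //.
by rewrite (negPf (nconn_color _ _ nxz)) //= => /eqP.
Qed.

(** Disconnectedness is always certified below by a set [B] that no [k]-edge leaves. *)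
Lemma closed_nconn (A B : {set T}) k x y : x \in B -> y \notin B ->
  (forall b u, b \in B -> u \in A -> u \notin B -> w b u != k) ->
  ~~ conn A k x y.
Proof.
move=> xB yB cl; apply: contra yB => /connectP[p].
elim: p x xB => [|u p IH] x xB /=; first by move=> _ ->.
case/andP=> /and4P[_ uA _ wxu]; apply: IH.
by apply: contraLR wxu => /cl; apply.
Qed.

(* Gallai's theorem: a vertex [v] is removed and the smaller set is split by a
   color [k]. If [v] has a [k]-edge to every component, then a component [B]
   receiving an edge of color [l != k] from [v] sees only [l] in the other
   components, so [B] is closed for the third color. *)
Lemma gallai_disconnected (A : {set T}) : 1 < #|A| ->
  exists k x y, [/\ x \in A, y \in A & ~~ conn A k x y].
Proof.
have [m] := ubnP #|A|; elim: m A => // m IH A ltAm A_gt1.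
have [v vA] : exists v, v \in A by apply/card_gt0P; apply: leq_trans A_gt1.
have cA' : #|A| = #|A :\ v|.+1 by rewrite (cardsD1 v) vA.
have out_v u : u \in A -> u \notin [set v] -> u \in A :\ v.
  by rewrite !inE => -> ->.
have iso k : (forall u, u \in A :\ v -> w v u != k) ->
    exists k x y, [/\ x \in A, y \in A & ~~ conn A k x y].
  move=> vk; have /card_gt0P[y] : 0 < #|A :\ v| by rewrite cA' in A_gt1.
  rewrite !inE => /andP[yv yA]; exists k, v, y; split=> //.
  apply: (@closed_nconn _ [set v]); rewrite ?inE // => b u.
  by rewrite inE => /eqP-> uA uv; apply: vk; apply: out_v.
have [A'_gt1|A'_le1] := ltnP 1 #|A :\ v|; last first.
  have /card_gt0P[y yA'] : 0 < #|A :\ v| by rewrite cA' in A_gt1.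
  have [k /andP[kw _]] := third_color (w v y) (w v y).
  apply: (iso k) => u uA'; rewrite eq_sym.
  by rewrite (card_le1_eqP A'_le1 y u yA' uA').
have [|k [x0 [y0 [x0A y0A nxy0]]]] := IH (A :\ v) _ A'_gt1.
  by rewrite cA' in ltAm.
set A' := A :\ v in IH cA' out_v iso A'_gt1 x0A y0A nxy0.
have sA' u : u \in A' -> u \in A /\ u != v by rewrite !inE => /andP[].
(* A component of [A'] with no [k]-edge to [v] remains closed after [v] is put back. *)
have [/existsP[x /andP[xA' /forallP farx]]|] :=
  boolP [exists x, (x \in A') && [forall u, conn A' k x u ==> (w v u != k)]].
  exists k, x, v; split=> //; first by case: (sA' _ xA').
  apply: (@closed_nconn _ [set u | conn A' k x u]); rewrite ?inE ?connect0 //.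
    by apply/negP => /(conn_in xA'); rewrite !inE eqxx.
  move=> b u; rewrite !inE => xb uA nxu.
  have [->|uv] := eqVneq u v; first by rewrite wC; exact: (implyP (farx b)).
  apply: (@nconn_color A'); rewrite ?(conn_in xA' xb) ?inE ?uv //.
  by apply: contra nxu; apply: connect_trans.
rewrite negb_exists => /forallP near.
have {near} nearP x : x \in A' -> exists2 u, conn A' k x u & w v u = k.
  move=> xA'; have := near x; rewrite xA' /= negb_forall => /existsP[u].
  by rewrite negb_imply negbK => /andP[xu /eqP wvu]; exists u.
(* If every edge at [v] has color [k], any other color isolates [v]. *)
have [/existsP[y /andP[yA' wvy]]|] :=
  boolP [exists y, (y \in A') && (w v y != k)]; last first.
  rewrite negb_exists => /forallP allk.
  have [l /andP[lk _]] := third_color k k.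
  apply: (iso l) => u uA'; have := allk u; rewrite uA' /= negbK => /eqP->.
  by rewrite eq_sym.
have v_neq u : u \in A' -> v != u by move/sA'=> []; rewrite eq_sym.
have [t /andP[lk ll]] := third_color k (w v y).
(* Let [x] be a [k]-neighbor of [v] in the component of [u]. The triangle on [v], [y], [x] gives
   [x y] the color of [v y]; [conn_mono] carries it to [b x] and [b u]. Then the triangle on [v],
   [b], [x] keeps color [t] off [v b]. *)
have mono_y u b : u \in A' -> ~~ conn A' k y u -> conn A' k y b ->
    w b u = w v y /\ w v b != t.
  move=> uA' nyu yb; have [x ux wvx] := nearP u uA'.
  have xA' := conn_in uA' ux.
  have nyx : ~~ conn A' k y x.
    by apply: contra nyu => yx; apply: connect_trans yx _; rewrite conn_sym.
  have bA' := conn_in yA' yb.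
  have nbx : ~~ conn A' k b x.
    by apply: contra nyx; apply: connect_trans.
  have wyx : w y x = w v y.
    have := gallai_triangle (v_neq y yA') (nconn_neq nyx) (v_neq x xA').
    rewrite wvx (negPf wvy) (negPf (nconn_color yA' xA' nyx)) /= orbF.
    by move/eqP.
  have wbx : w b x = w v y by rewrite (conn_mono yA' xA' yb nyx).
  split.
    have nub : ~~ conn A' k x b by rewrite conn_sym.
    have xu : conn A' k x u by rewrite conn_sym.
    by rewrite wC (conn_mono xA' bA' xu nub) wC.
  have := gallai_triangle (v_neq b bA') (nconn_neq nbx) (v_neq x xA').
  rewrite wvx wbx (negPf wvy) orbF; case/orP=> /eqP->; by rewrite eq_sym.
exists t, y, v; split=> //; first by case: (sA' _ yA').
apply: (@closed_nconn _ [set u | conn A' k y u]); rewrite ?inE ?connect0 //.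
  by apply/negP => /(conn_in yA'); rewrite !inE eqxx.
move=> b u; rewrite !inE => yb uA nyu.
have [uv|uv] := eqVneq u v; last first.
  by have [|-> _] := mono_y u b _ nyu yb; rewrite ?inE ?uv // eq_sym.
(* Even for the edge to [v], [mono_y] needs a vertex outside the component of [y]; one of [x0], [y0]
   is such. *)
have [z zA' nyz] : exists2 z, z \in A' & ~~ conn A' k y z.
  have [yx0|] := boolP (conn A' k y x0); last by exists x0.
  exists y0 => //; apply: contra nxy0; apply: connect_trans.
  by rewrite conn_sym.
by rewrite uv wC; case: (mono_y z b zA' nyz yb).
Qed.

(** * The product bound *)

(** Counting the values used on [A], instead of chromatic numbers, lets the same fixed colorings be
    restricted to components in the induction. *)
Lemma gallai_card_bound (D : 'I_3 -> finType) (f : forall k, T -> D k) :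
  (forall k x y, x != y -> f k x = f k y -> w x y = k) ->
  forall A : {set T}, #|A| ^ 2 <= \prod_k #|f k @: A|.
Proof.
move=> hf A; have [m] := ubnP #|A|; elim: m A => // m IH A ltAm.
have [A_gt1|] := ltnP 1 #|A|; last first.
  case: (posnP #|A|) => [->//|A_gt0 A_le1].
  apply: (@leq_trans 1); first by case: #|A| A_le1 => [|[]].
  apply: prodn_cond_gt0 => k _; have /card_gt0P[a aA] := A_gt0.
  by apply/card_gt0P; exists (f k a); apply: imset_f.
have [k [x0 [y0 [x0A y0A nxy0]]]] := gallai_disconnected A_gt1.
have [i /andP[ik _]] := third_color k k.
have [j /andP[ji jk]] := third_color i k.
have prodE F : \prod_l F l = F k * (F i * F j).
  by apply: prod_ord3; rewrite // eq_sym.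
pose P := equivalence_partition (conn A k) A.
have eqv : {in A & &, equivalence_rel (conn A k)}.
  move=> x y z _ _ _; split; first exact: connect0.
  by move=> xy; apply: (same_connect (@conn_sym A k)).
have partP : partition P A := equivalence_partitionP eqv.
have [/eqP covP trivP _] := and3P partP.
have blockA V x : V \in P -> x \in V -> x \in A.
  by move=> VP xV; rewrite -covP; apply/bigcupP; exists V.
have blockE V W x y : V \in P -> W \in P -> x \in V -> y \in W ->
    conn A k x y = (V == W).
  move=> VP WP xV yW; have xA := blockA _ _ VP xV; have yA := blockA _ _ WP yW.
  rewrite -(pblock_equivalence_partition eqv) // -/P.
  rewrite -eq_pblock ?covP //.
  by rewrite (def_pblock trivP VP xV) (def_pblock trivP WP yW).
rewrite {1}(card_partition partP) prodE.
apply: (@leq_trans ((\sum_(V in P) #|f k @: V|) *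
                    (\sum_(V in P) #|f i @: V| * #|f j @: V|))).
  apply: sum_cauchy_schwarz => V VP; rewrite -(prodE (fun l => #|f l @: V|)).
  rewrite ltnS in ltAm; apply: IH; apply: leq_trans ltAm; apply: proper_card.
  apply/properP; split; first by apply/subsetP => x; apply: blockA.
  have [x0V|] := boolP (x0 \in V); last by exists x0.
  exists y0 => //; apply: contra nxy0 => y0V.
  by rewrite (blockE V V).
apply: leq_mul.
  (* A value of [f k] shared by two components would force a [k]-edge between them. *)
  apply: sum_card_disjoint => [V VP|V W d VP WP].
    by apply: imsetS; apply/subsetP => x; apply: blockA.
  case/imsetP=> x xV -> /imsetP[y yW fxy]; apply/eqP; apply: contraT => nVW.
  have nxy : ~~ conn A k x y by rewrite (blockE V W).
  have := nconn_color (blockA _ _ VP xV) (blockA _ _ WP yW) nxy.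
  by rewrite (hf _ _ _ (nconn_neq nxy) fxy) eqxx.
rewrite -cardsX; under eq_bigr do rewrite -cardsX.
(* A shared pair yields an [i]-edge [x y] and a [j]-edge [x' y'] between [V] and [W], whereas two
   uses of [conn_mono] show that these edges have the same color. *)
apply: sum_card_disjoint => [V VP|V W [d d'] VP WP].
  by apply: setXS; apply: imsetS; apply/subsetP => x; apply: blockA.
rewrite !inE /= => /andP[/imsetP[x xV ->] /imsetP[x' xV' ->]].
case/andP=> /imsetP[y yW fxy] /imsetP[y' yW' fxy'].
apply/eqP; apply: contraT => nVW.
have nconn a b : a \in V -> b \in W -> ~~ conn A k a b.
  by move=> aV bW; rewrite (blockE V W).
have wi := hf _ _ _ (nconn_neq (nconn _ _ xV yW)) fxy.
have wj := hf _ _ _ (nconn_neq (nconn _ _ xV' yW')) fxy'.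
have xx' : conn A k x x' by rewrite (blockE V V).
have yy' : conn A k y y' by rewrite (blockE W W).
have nyx' : ~~ conn A k y x' by rewrite conn_sym nconn.
case/eqP: ji; rewrite -wi -wj wC.
rewrite (conn_mono (blockA _ _ WP yW) (blockA _ _ VP xV') yy' nyx') wC.
by rewrite (conn_mono (blockA _ _ VP xV) (blockA _ _ WP yW) xx') // nconn.
Qed.

Lemma gallai_chromatic_prod :
  #|T| ^ 2 <= \prod_k chromatic_number (color_graph c (~: [set k])).
Proof.
pose chi k := chromatic_number (color_graph c (~: [set k])).
have col k : exists f : {ffun T -> 'I_(chi k)},
    [forall x, forall y, color_graph c (~: [set k]) x y ==> (f x != f y)].
  by apply/existsP; rewrite /chi /chromatic_number; case: ex_minnP.
pose f k := xchoose (col k).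
(* Distinct vertices with equal values are nonadjacent in the graph avoiding [k], so their edge has
   color [k]. *)
have hf k x y : x != y -> f k x = f k y -> w x y = k.
  move=> xy fxy; have /forallP/(_ x)/forallP/(_ y) := xchooseP (col k).
  rewrite /= /color_adj xy -/(f k) fxy eqxx !inE implybF negbK => /eqP; exact.
rewrite -cardsT; apply: leq_trans (gallai_card_bound hf setT) _.
by apply: leq_prod => k _; rewrite -[leqRHS]card_ord max_card.
Qed.

End Gallai.

Local Open Scope ring_scope.
Import Order.TTheory GRing.Theory Num.Theory.

Theorem theorem1p2 (R : realType) (n : nat) (hn : (1 <= n)%N)
    (c : {set 'I_n} -> 'I_3) (hc : gallai_coloring c) :
  exists S : {set 'I_3}, (#|S| <= 2)%N /\
    (n%:R : R) `^ (2%:R / 3%:R) <= (chromatic_number (color_graph c S))%:R.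
Proof.
pose chi k := chromatic_number (color_graph c (~: [set k])).
(* The largest of the three factors is at least the cube root of their product. *)
have [k _ kmax] := @arg_maxnP _ ord0 predT chi isT.
exists (~: [set k]); split; first by rewrite cardsC1 card_ord.
have le3 : (n ^ 2 <= chi k ^ 3)%N.
  have := gallai_chromatic_prod hc; rewrite card_ord => /leq_trans; apply.
  rewrite -[X in (_ <= _ ^ X)%N](card_ord 3) -prod_nat_const.
  by apply: leq_prod => l _; apply: kmax.
(* Both sides become cube roots, of [n ^ 2] and of [chi k ^ 3]. *)
rewrite -/(chi k) powRrM powR_mulrn // -[leRHS]powRr1 //.
rewrite -[X in _ <= _ `^ X](@divff R 3%:R) ?pnatr_eq0 // powRrM powR_mulrn //.
by rewrite ge0_ler_powR ?nnegrE ?exprn_ge0 ?invr_ge0 -?natrX ?ler_nat.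
Qed.
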